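(* Suppose $\alpha\in S_n$ consists of a $d_1$-cycle, a $d_2$-cycle and $d_\infty$ fixed points, where $d_1\ge d_2>1$ and $d_\infty\ge 0$ (so $n=d_1+d_2+d_\infty$). If $d_1=d_2$ then $\alpha\in\mathrm{Aut}(n)$ if and only if $0\le d_\infty\le 2d_1$. If $d_1>d_2$ then $\alpha\in\mathrm{Aut}(n)$ if and only if all of the following conditions hold: (a) $d_2$ divides $d_1$, (b) $d_2\ge d_\infty$, (c) if $d_2$ is even then $d_\infty>0$.
   Context: A Latin square of order $n$ is an $n\times n$ array $L=L(i,j)$ with rows, columns and symbols indexed by $[n]=\{1,\dots,n\}$ such that the symbols in every row and in every column are distinct. $S_n$ is the symmetric group on $[n]$. A permutation $\alpha\in S_n$ is an automorphism of $L$ if $\alpha(L(i,j))=L(\alpha(i),\alpha(j))$ for all $i,j\in[n]$. $\mathrm{Aut}(n)$ denotes the set of all $\alpha\in S_n$ that are an automorphism of at least one Latin square of order $n$. *)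

(* Defs.v *)
From mathcomp Require Import all_boot all_fingroup matrix.

Set Implicit Arguments.
Unset Strict Implicit.
Unset Printing Implicit Defensive.

(* Rows, columns and symbols are indexed by 'I_n = {0, ..., n-1}, standing for
   [n] = {1, ..., n}; L i j is the symbol in row i and column j. *)
Definition latin_square (n : nat) (L : 'M['I_n]_n) : bool :=
  [forall i, injectiveb (fun j => L i j)]
  && [forall j, injectiveb (fun i => L i j)].

Definition latin_automorphism (n : nat) (L : 'M['I_n]_n) (a : 'S_n) : bool :=
  [forall i, forall j, a (L i j) == L (a i) (a j)].

Definition latin_Aut (n : nat) : {set 'S_n} :=
  [set a : 'S_n | [exists L : 'M['I_n]_n,
                     latin_square L && latin_automorphism L a]].

(* porbits a is the set of all cycles of a (as subsets of 'I_n), fixed points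
   included as cycles of length 1. *)
Definition cycle_lengths (n : nat) (a : 'S_n) : seq nat :=
  [seq #|C| | C : {set 'I_n} <- enum (porbits a)].

(* The list of lengths, with multiplicity, is compared up to reordering;
   n = d1 + d2 + dinf is a consequence. *)
Definition two_cycles_and_fixed_points
    (n : nat) (a : 'S_n) (d1 d2 dinf : nat) : bool :=
  perm_eq (cycle_lengths a) (d1 :: d2 :: nseq dinf 1).

(* Main.v *)
(* Let A be the longer cycle (of length D), identified with Z/D, and X the other
   points.  A row of A is determined by row 0, so extending an equivariant Latin
   square on X amounts to choosing a partial orthomorphism k |-> k + delta k of
   Z/D (the cells of A x A with symbol in A) together with injections m1, m2, m3
   of X into the complements of its domain, of its image and of the image of
   delta (symbols in X, columns in X, rows in X).  The only further condition is
   that x |-> act (- m x) x be injective for each of the three.  With X fixed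
   pointwise this settles one cycle plus fixed points; taking for X the resulting
   square on the second cycle and the fixed points settles d2 < d1; squaring a
   2d-cycle settles d1 = d2 when there is a fixed point, and without fixed points
   explicit formulas on Z/2 x Z/d do.
   Conversely, two of the cycle lengths of x, y and L x y dividing k force the
   third one to divide k; hence the restrictions on d1, d2 and dinf, except for
   the parity condition, which comes from the sum of all elements of Z/d2. *)

Require Import Defs.
From mathcomp Require Import all_boot all_fingroup ssralg finalg zmodp matrix.
From mathcomp Require Import zify.

Set Implicit Arguments.
Unset Strict Implicit.
Unset Printing Implicit Defensive.

Import GRing.Theory.

(** * Extension of an equivariant Latin square by one cycle *)

Definition latin_op (T : Type) (op : T -> T -> T) : Prop :=
  (forall x, injective (op x)) /\ (forall y, injective (op^~ y)).

Definition shift (Z : zmodType) (X : Type) (act : Z -> X -> X) (a : Z)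
    (t : Z + X) : Z + X :=
  match t with inl i => inl (a + i)%R | inr x => inr (act a x) end.

Definition twisted_injective (Z : zmodType) (X : Type) (act : Z -> X -> X)
    (m : X -> Z) : Prop :=
  injective m /\ injective (fun x => act (- m x)%R x).

Local Open Scope ring_scope.

(** By equivariance only row 0 and column 0 matter among those indexed by [Z]. Row 0 contains
    [k + delta k], the elements of [X] and [m2]; column 0 contains [delta k], the twist of [m1] and
    [m3]. The twists of [m2] and [m3] serve the columns and rows indexed by [X]. *)
Lemma bordered_latin (Z : finZmodType) (X : finType) (act : Z -> X -> X)
    (xop : X -> X -> X) (K : {set Z}) (delta : Z -> Z) (m1 m2 m3 : X -> Z) :
  (forall x, act 0 x = x) ->
  (forall a b x, act (a + b) x = act a (act b x)) ->
  latin_op xop -> (forall a, {morph act a : x y / xop x y}) ->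
  (#|K| + #|X| = #|Z|)%N ->
  {in K &, injective (fun k => k + delta k)} -> {in K &, injective delta} ->
  twisted_injective act m1 -> twisted_injective act m2 ->
  twisted_injective act m3 ->
  (forall x, m1 x \notin K) ->
  (forall x k, k \in K -> m2 x != k + delta k) ->
  (forall x k, k \in K -> m3 x != delta k) ->
  exists2 op, latin_op op & forall a, {morph shift act a : s t / op s t}.
Proof.
move=> act0 actD [xopr xopc] xopA cardK gK dK [m1I m1T] [m2I m2T] [m3I m3T].
move=> m1K m2K m3K.
pose row0 k : Z + X :=
  if [pick x | m1 x == k] is Some x then inr x else inl (k + delta k).
have row0m x : row0 (m1 x) = inr x.
  rewrite /row0; case: pickP => [y /eqP/m1I-> //|/(_ x)]; by rewrite eqxx.
have row0K k : k \in K -> row0 k = inl (k + delta k).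
  rewrite /row0; case: pickP => // y /eqP<- yK; by case/negP: (m1K y).
have cover k : k \in K \/ exists x, k = m1 x.
  (* [K] and the image of [m1] are disjoint and their sizes add up to [#|Z|]. *)
  have /eqP KU : K :|: [set m1 x | x : X] == [set: Z].
    have dis : [disjoint K & [set m1 x | x : X]].
      rewrite disjoint_sym disjoint_subset; apply/subsetP=> _ /imsetP[x _ ->].
      by rewrite inE m1K.
    by rewrite eqEcard subsetT cardsT -cardK cardsU (disjoint_setI0 dis) cards0
               subn0 card_imset /=.
  have : k \in K :|: [set m1 x | x : X] by rewrite KU inE.
  by case/setUP=> [|/imsetP[x _ ->]]; [left | right; exists x].
pose op s t : Z + X := match s, t with
  | inl i, inl j => shift act i (row0 (j - i))
  | inl i, inr x => inl (i + m2 (act (- i) x))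
  | inr x, inl j => inl (j + m3 (act (- j) x))
  | inr x, inr y => inr (xop x y) end.
have shiftD a b t : shift act (a + b) t = shift act a (shift act b t).
  by case: t => [i|x] /=; rewrite ?addrA ?actD.
have shift0 t : shift act 0 t = t by case: t => [i|x] /=; rewrite ?add0r ?act0.
have shiftK a : cancel (shift act a) (shift act (- a)).
  by move=> t; rewrite -shiftD addNr shift0.
have opA a : {morph shift act a : s t / op s t}.
  move=> [i|x] [j|y] /=.
  - by rewrite -shiftD opprD addrACA subrr add0r.
  - by rewrite -actD opprD (addrAC (- a)) addNr add0r addrA.
  - by rewrite -actD opprD (addrAC (- a)) addNr add0r addrA.
  - by rewrite xopA.
have twist_inj (m : X -> Z) x : injective (fun y => act (- m y) y) ->
    injective (fun j => j + m (act (- j) x)).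
  move=> mT j j' E.
  (* With [y := act (- j) x], the twist [act (- m y) y] equals [act (- (j + m y)) x], so it depends
     only on [x] and the value at [j]. *)
  suff Ex : act (- j) x = act (- j') x by move: E; rewrite Ex => /addIr.
  by apply: mT; rewrite -!actD -!opprD ![m _ + _]addrC E.
have row0I : injective (op (inl 0)).
  move=> [i|x] [j|y] /=; rewrite ?subr0 ?oppr0 ?shift0 ?add0r ?act0.
  - case: (cover i) (cover j) => [iK|[x ->]] [jK|[y ->]]; rewrite ?row0m ?row0K //.
      by case=> E; rewrite (gK _ _ iK jK E).
    by case=> ->.
  - case: (cover i) => [iK|[z ->]]; rewrite ?row0m ?row0K //.
    by case=> E; case/eqP: (m2K y _ iK).
  - case: (cover j) => [jK|[z ->]]; rewrite ?row0m ?row0K //.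
    by case=> E; case/eqP: (m2K x _ jK).
  - by case=> /m2I->.
have col0I s t : op s (inl 0) = op t (inl 0) -> s = t.
  (* The cell [(- k, 0)] is the translate by [- k] of [(0, k)]: it contains [delta k], or
     [act (- m1 x) x] if [k = m1 x]. *)
  have colE k : op (inl (- k)) (inl 0) = shift act (- k) (row0 k).
    by rewrite /= sub0r opprK.
  have colx x : op (inr x) (inl 0) = inl (m3 x) by rewrite /= oppr0 act0 add0r.
  have clash k x : op (inl (- k)) (inl 0) <> op (inr x) (inl 0).
    rewrite colE colx; case: (cover k) => [kK|[z ->]]; rewrite ?row0m ?row0K //=.
    by case; rewrite addKr => /esym/eqP; apply/negP/m3K.
  case: s t => [i|x] [j|y].
  - rewrite -[i]opprK -[j]opprK colE colE.
    case: (cover (- i)) (cover (- j)) => [iK|[x ->]] [jK|[y ->]];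
      rewrite ?row0m ?row0K //=.
      by case; rewrite !addKr => E; rewrite (dK _ _ iK jK E).
    by case=> /m1T->.
  - by rewrite -[i]opprK => /clash.
  - by rewrite -[j]opprK => /esym/clash.
  - by rewrite !colx => -[] /m3I->.
have inlE (i : Z) : inl i = shift act i (inl 0) by rewrite /= addr0.
exists op => //; split=> -[i|x].
- move=> s t; rewrite inlE -[s](shiftK (- i)) -[t](shiftK (- i)) opprK -!opA.
  by move=> /(can_inj (shiftK i))/row0I->.
- move=> [j|y] [j'|y'] //= [].
    by move=> /(twist_inj _ _ m3T)->.
  by move=> /xopr->.
- move=> s t; rewrite inlE -[s](shiftK (- i)) -[t](shiftK (- i)) opprK -!opA.
  by move=> /(can_inj (shiftK i))/col0I->.
- move=> [j|y] [j'|y'] //= [].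
    by move=> /(twist_inj _ _ m2T)->.
  by move=> /xopc->.
Qed.

Local Close Scope ring_scope.

(** * Modular arithmetic for the partial orthomorphism and the injections *)

Lemma eq_mod_window d x y : x = y %[mod d] -> x < y + d -> y < x + d -> x = y.
Proof.
wlog le_xy : x y / x <= y.
  by move=> H; case/orP: (leq_total x y) => /H{}H E *; [|symmetry]; apply: H.
move/eqP; rewrite eq_sym eqn_mod_dvd // => dv _ lt_yx; move: dv lt_yx.
case: (posnP (y - x)) => [|y_x /(dvdn_leq y_x)]; lia.
Qed.

Lemma modn_lt_double D x : x < 2 * D -> x %% D = if x < D then x else x - D.
Proof.
case: (ltnP x D) => [lt_xD _|le_Dx lt_x]; first exact: modn_small.
by rewrite -{1}(subnK le_Dx) modnDr modn_small //; lia.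
Qed.

(* delta := step D e on [0, D - e): for odd D it is the identity (the conditional
   never applies there), giving k |-> 2k; for even D the shift by the odd number e
   past D/2 moves the second half of the doubled values to odd residues. *)
Definition breakpoint D e := if odd D then D - e else minn D./2 (D - e).

Definition step D e j := if breakpoint D e <= j then j + e else j.

Lemma step_lt D e j : j < D - e -> step D e j < D.
Proof. by rewrite /step; case: ifP; lia. Qed.

Lemma step_inj D e j j' : step D e j = step D e j' -> j = j'.
Proof. by rewrite /step; case: ifP; case: ifP; lia. Qed.

Lemma step_double_inj D e j j' : odd D || odd e -> j < D - e -> j' < D - e ->
  j + step D e j = j' + step D e j' %[mod D] -> j = j'.
Proof.
move=> odd_De ltj ltj'; have := step_lt ltj; have := step_lt ltj'.
move=> lt1 lt2; rewrite !modn_lt_double; try lia.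
move: lt1 lt2 odd_De; rewrite /step /breakpoint.
case: (boolP (odd D)) => odd_D; do !case: ifP; lia.
Qed.

(* halving d is multiplication by 1/2 modulo the odd number odd_bound d, restricted
   to [0, d), so that b - halving d b takes d consecutive values. *)
Definition odd_bound d := d + ~~ odd d.
Definition halving d b := if odd b then (b + odd_bound d)./2 else b./2.

Lemma halving_lt d b : b < d -> halving d b < odd_bound d.
Proof. by rewrite /halving /odd_bound; case: ifP; lia. Qed.

Lemma halving_inj d b b' : b < d -> b' < d -> halving d b = halving d b' -> b = b'.
Proof. by rewrite /halving /odd_bound; do !case: ifP; lia. Qed.

(** The values [b - halving d b] stay in a window of length [d], so congruence is equality. This is
    the twist condition on a cycle of length [d], written additively because subtraction on [nat]
    truncates. *)
Lemma halving_twist d s b b' : b < d -> b' < d ->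
  b + (s + halving d b') = b' + (s + halving d b) %[mod d] -> b = b'.
Proof.
move=> ltb ltb' /eqP; rewrite !(addnCA _ s) eqn_modDl => /eqP/eq_mod_window.
by rewrite /halving /odd_bound; do !case: ifP; lia.
Qed.

(** The [odd_bound d] values from [breakpoint] on are free: [step] jumps over them or stops short of
    them. By [halving_lt] the halved values fit into this gap. *)
Lemma step_avoids_halving D d j b : 2 * d <= D -> j < D - odd_bound d -> b < d ->
  breakpoint D (odd_bound d) + halving d b <> step D (odd_bound d) j.
Proof.
move=> le_dD ltj ltb; have := halving_lt ltb; move: ltj.
rewrite /step /breakpoint /odd_bound; case: (boolP (odd D)); case: ifP; lia.
Qed.

(* The values of k + step D (odd_bound d) k avoid d terms, modulo D, of the
   progression of difference 2 starting here. *)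
Definition double_start D d :=
  if odd D then D - 2 * odd_bound d else D - odd_bound d.

(** For odd [D] the terms are congruent to the doubles of numbers from [D - odd_bound d] on, outside
    the domain. For even [D] and [e = odd_bound d] they are odd and lie between [D - e] and
    [D + e - 2], while the odd residues taken lie between [e] and [D - e - 2]. *)
Lemma step_double_avoids D d j b : 2 * d <= D -> (odd D -> odd d) ->
  j < D - odd_bound d -> b < d ->
  double_start D d + 2 * b <> j + step D (odd_bound d) j %[mod D].
Proof.
move=> le_dD odd_Dd ltj ltb; have := step_lt ltj => lt1.
have lt2 : double_start D d + 2 * b < 2 * D by rewrite /double_start; case: ifP; lia.
have lt3 : j + step D (odd_bound d) j < 2 * D by lia.
rewrite (modn_lt_double lt2) (modn_lt_double lt3) {lt2 lt3}.
move: lt1 ltj; rewrite /step /breakpoint /double_start /odd_bound.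
case: (boolP (odd D)) => [/[dup] /odd_Dd -> odd_D|odd_D]; do !case: ifP; lia.
Qed.

(** * One cycle with fixed points *)

Lemma injection_avoiding (Z : finType) (S : {set Z}) f : #|S| + f <= #|Z| ->
  exists2 m : 'I_f -> Z, injective m & forall x, m x \notin S.
Proof.
rewrite -(cardsC S) leq_add2l => le_f.
exists (fun x => enum_val (widen_ord le_f x)) => [x y | x].
  by move=> /enum_val_inj/(congr1 val) E; apply: val_inj.
by have := enum_valP (widen_ord le_f x); rewrite inE.
Qed.

Lemma inZpD p a b : (inZp a + inZp b)%R = inZp (a + b) :> 'I_p.+1.
Proof. by apply: val_inj; rewrite /= modnDm. Qed.

Lemma inZp_eq p a b : inZp a = inZp b :> 'I_p.+1 -> a = b %[mod p.+1].
Proof. by move=> /(congr1 val). Qed.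

Definition rotate q f (a : 'I_q.+1) : 'I_q.+1 + 'I_f -> 'I_q.+1 + 'I_f :=
  shift (fun _ x => x) a.

Lemma rotateD q f (a b : 'I_q.+1) (x : 'I_q.+1 + 'I_f) :
  rotate (a + b)%R x = rotate a (rotate b x).
Proof. by case: x => //= i; rewrite addrA. Qed.

Lemma rotate0 q f (x : 'I_q.+1 + 'I_f) : rotate 0%R x = x.
Proof. by case: x => //= i; rewrite add0r. Qed.

Lemma latin_mod f : exists op : 'I_f -> 'I_f -> 'I_f, latin_op op.
Proof.
case: f => [|f]; first by exists (fun x _ => x); split=> -[].
exists (fun x y => x + y)%R; split=> x; [exact: addrI | exact: addIr].
Qed.

Definition initial p (k : nat) : {set 'I_p.+1} := [set i : 'I_p.+1 | i < k].

Lemma card_initial p k : k <= p.+1 -> #|initial p k| = k.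
Proof.
move=> le_k; have wI : injective (widen_ord le_k).
  by move=> i j /(congr1 val) E; apply: val_inj.
rewrite -[RHS](card_ord k) -cardsT -(card_imset _ wI).
apply: eq_card => i; rewrite inE; apply/idP/imsetP => [lt_ik | [j _ ->]];
  last exact: ltn_ord j.
by exists (Ordinal lt_ik) => //; apply: val_inj.
Qed.

Definition stepZ p e (j : 'I_p.+1) : 'I_p.+1 := inZp (step p.+1 e j).

Lemma stepZ_inj p e f : f <= p.+1 - e ->
  {in initial p f &, injective (stepZ (p := p) e)}.
Proof.
move=> le_fe i j; rewrite !inE => lti ltj /inZp_eq.
rewrite !modn_small; try by apply: step_lt; lia.
by move=> /step_inj/val_inj.
Qed.

Lemma addr_stepZ p e (j : 'I_p.+1) : (j + stepZ e j)%R = inZp (j + step p.+1 e j).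
Proof. by rewrite -inZpD valZpK. Qed.

Lemma stepZ_double_inj p e f : odd p.+1 || odd e -> f <= p.+1 - e ->
  {in initial p f &, injective (fun j : 'I_p.+1 => j + stepZ e j)%R}.
Proof.
move=> odd_pe le_fe i j; rewrite !inE !addr_stepZ => lti ltj /inZp_eq.
by move=> /(step_double_inj odd_pe) H; apply/val_inj/H; lia.
Qed.

(** The action on ['I_f] is trivial, so twisted injectivity is plain injectivity, and cardinality
    alone provides the three injections. *)
Lemma single_cycle_latin p f : f <= p.+1 -> odd p.+1 || (0 < f) ->
  exists2 op : 'I_p.+1 + 'I_f -> 'I_p.+1 + 'I_f -> 'I_p.+1 + 'I_f,
    latin_op op & forall a, {morph rotate a : s t / op s t}.
Proof.
move=> le_fp odd_pf; have [xop xopL] := latin_mod f.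
(* If [p.+1] is even then [e = 1] and [0 < f], so [K] still lies below [p.+1 - e]. *)
set K := initial p (p.+1 - f); pose e := nat_of_bool (~~ odd p.+1).
have cardK : #|K| = p.+1 - f by rewrite card_initial //; lia.
have le_e : p.+1 - f <= p.+1 - e by rewrite /e; lia.
have ex (S : {set 'I_p.+1}) : #|S| <= #|K| -> exists2 m : 'I_f -> 'I_p.+1,
    twisted_injective (fun _ x => x) m & forall x, m x \notin S.
  move=> le_S; have [|m mI mS] := @injection_avoiding _ S f.
    by rewrite card_ord; lia.
  by exists m => //; split=> // x y.
have [m1 m1I m1K] := ex K (leqnn _).
have [m2 m2I m2K] := ex [set (k + stepZ e k)%R | k in K] (leq_imset_card _ _).
have [m3 m3I m3K] := ex [set stepZ e k | k in K] (leq_imset_card _ _).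
apply: (@bordered_latin _ _ (fun _ x => x) xop K (stepZ e) m1 m2 m3) => //.
- by rewrite cardK !card_ord subnK.
- by apply: stepZ_double_inj => //; rewrite /e; case: (odd _).
- exact: stepZ_inj.
- by move=> x k kK; apply: contraNneq (m2K x) => ->; apply: imset_f.
- by move=> x k kK; apply: contraNneq (m3K x) => ->; apply: imset_f.
Qed.

(** * Two cycles of different lengths *)

(** Only the cycle of length [q.+1] needs a prescribed map: rotations fix ['I_f] pointwise, so its
    points may go to any elements left over. Divisibility makes the reduction [red] additive, which
    turns the twist into a congruence modulo [q.+1]. *)
Lemma twisted_extension p q f (u : nat -> nat) (S : {set 'I_p.+1}) :
  q.+1 %| p.+1 -> #|S| + (q.+1 + f) <= p.+1 ->
  (forall b b', b < q.+1 -> b' < q.+1 -> u b = u b' %[mod p.+1] -> b = b') ->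
  (forall b b', b < q.+1 -> b' < q.+1 ->
     b + u b' = b' + u b %[mod q.+1] -> b = b') ->
  (forall b, b < q.+1 -> inZp (u b) \notin S) ->
  exists2 m : 'I_q.+1 + 'I_f -> 'I_p.+1,
    twisted_injective (fun a => rotate (inZp (a : 'I_p.+1))) m &
    forall x, m x \notin S.
Proof.
move=> dv_qp le_S uI uT uS.
pose mu (b : 'I_q.+1) : 'I_p.+1 := inZp (u b).
have muI : injective mu by move=> b b' /inZp_eq/uI H; apply/val_inj/H.
pose S' := S :|: [set mu b | b : 'I_q.+1].
have [|m mI mS'] := @injection_avoiding _ S' f.
  rewrite card_ord; have := cardsU S [set mu b | b : 'I_q.+1].
  by rewrite -/S' card_imset // card_ord; lia.
pose red (a : 'I_p.+1) : 'I_q.+1 := inZp a.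
have redD a b : red (a + b)%R = (red a + red b)%R.
  by rewrite /red inZpD; apply: val_inj; rewrite /= modn_dvdm.
have redN a : red (- a)%R = (- red a)%R.
  by apply/eqP; rewrite -addr_eq0 -redD addNr; apply/eqP/val_inj; rewrite /= mod0n.
have red_mu b : red (mu b) = inZp (u b).
  by apply: val_inj; rewrite /= modn_dvdm.
exists (fun x => match x with inl b => mu b | inr y => m y end); first split.
- move=> [b|y] [b'|y'].
  + by move/muI->.
  + by move=> E; case/negP: (mS' y'); rewrite -E !inE imset_f ?orbT.
  + by move=> E; case/negP: (mS' y); rewrite E !inE imset_f ?orbT.
  + by move/mI->.
- have inlI (a b : 'I_q.+1) : inl a = inl b :> 'I_q.+1 + 'I_f -> a = b by case.
  move=> [b|y] [b'|y'] // => /inlI.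
  rewrite -!/(red _) !redN !red_mu => E; congr inl.
  suff /(congr1 val)/= : (b + inZp (u b') = b' + inZp (u b))%R.
    by rewrite /= !modnDmr => /uT H; apply/val_inj/H.
  rewrite -[b in LHS](addNKr (inZp (u b))) E -[b' in RHS](addNKr (inZp (u b'))).
  by rewrite addrAC [RHS]addrAC [(inZp (u b) + _)%R]addrC.
- move=> [b|y]; first exact: uS.
  by apply: contra (mS' y); rewrite !inE => ->.
Qed.

Lemma two_cycle_latin p q f : q.+1 %| p.+1 -> q < p -> f <= q.+1 ->
  odd q.+1 || (0 < f) ->
  exists2 op : 'I_p.+1 + ('I_q.+1 + 'I_f) -> 'I_p.+1 + ('I_q.+1 + 'I_f) ->
      'I_p.+1 + ('I_q.+1 + 'I_f),
    latin_op op &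
    forall a, {morph shift (fun a => rotate (inZp (a : 'I_p.+1))) a : s t / op s t}.
Proof.
move=> dv_qp lt_qp le_fq odd_qf.
have [xop xopL xopA] := single_cycle_latin le_fq odd_qf.
set K := initial p (p.+1 - (q.+1 + f)); pose e := odd_bound q.+1.
have le_dD : 2 * q.+1 <= p.+1.
  by have /dvdnP[k Ek] := dv_qp; rewrite Ek leq_mul2r; case: k Ek => [|[|k]]; lia.
have odd_pq : odd p.+1 -> odd q.+1 by exact: dvdn_odd.
have cardK : #|K| = p.+1 - (q.+1 + f) by rewrite card_initial; lia.
(* For even [q.+1], [e] exceeds it by 1, and a fixed point makes up for this. *)
have le_e : p.+1 - (q.+1 + f) <= p.+1 - e by rewrite /e /odd_bound; lia.
have le_ep : e <= p.+1 by rewrite /e /odd_bound; lia.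
have twist u : (forall b b', b < q.+1 -> b' < q.+1 ->
    b + u b' = b' + u b %[mod q.+1] -> b = b') ->
    forall S : {set 'I_p.+1}, #|S| <= #|K| ->
    (forall b b', b < q.+1 -> b' < q.+1 -> u b = u b' %[mod p.+1] -> b = b') ->
    (forall b, b < q.+1 -> inZp (u b) \notin S) ->
    exists2 m : 'I_q.+1 + 'I_f -> 'I_p.+1,
      twisted_injective (fun a => rotate (inZp (a : 'I_p.+1))) m &
      forall x, m x \notin S.
  by move=> uT S le_S uI uS; apply: (twisted_extension dv_qp) uI uT uS; lia.
have halvingI s : forall b b', b < q.+1 -> b' < q.+1 ->
    s + halving q.+1 b = s + halving q.+1 b' %[mod p.+1] -> b = b'.
  move=> b b' ltb ltb' /eqP; rewrite eqn_modDl => /eqP.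
  have := halving_lt ltb; have := halving_lt ltb'; rewrite -/e => lt1 lt2.
  by rewrite !modn_small; [exact: halving_inj | lia | lia].
(* [m1] puts the halved values into the last [e] residues, beyond [K]; below, [m3] puts them into
   the gap of [step]. *)
have [|||m1 m1I m1K] := twist _ (@halving_twist q.+1 (p.+1 - e)) K.
- exact: leqnn.
- exact: halvingI.
- move=> b ltb; have := halving_lt ltb; rewrite -/e => lt1.
  by rewrite inE /= modn_small; lia.
have [||m3 m3I m3K] := twist _ (@halving_twist q.+1 (breakpoint p.+1 e))
  [set stepZ e k | k in K] (leq_imset_card _ _).
- exact: halvingI.
- move=> b ltb; have lt1 := halving_lt ltb.
  apply/imsetP=> -[k]; rewrite inE => ltk /inZp_eq.
  rewrite !modn_small; [apply: step_avoids_halving => //; rewrite -/e; lia | |].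
    by apply: step_lt; lia.
  by move: lt1; rewrite /breakpoint -/e; case: ifP; lia.
(* With difference 2 the twist is [b - 2 * b = - b] up to a constant, hence injective. *)
have [|||m2 m2I m2K] := twist (fun b => double_start p.+1 q.+1 + 2 * b) _
  [set (k + stepZ e k)%R | k in K] (leq_imset_card _ _).
- move=> b b' ltb ltb' /eqP; rewrite !(addnCA _ (double_start _ _)) eqn_modDl.
  by move=> /eqP/eq_mod_window; lia.
- move=> b b' ltb ltb' /eqP; rewrite eqn_modDl !modn_small; lia.
- move=> b ltb; apply/imsetP=> -[k]; rewrite inE addr_stepZ => ltk /inZp_eq.
  by apply: step_double_avoids => //; rewrite -/e; lia.
apply: (@bordered_latin _ _ (fun a => rotate (inZp (a : 'I_p.+1))) xop K
  (stepZ e) m1 m2 m3) => //.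
- by move=> x; rewrite (_ : inZp _ = 0%R) ?rotate0 //; apply/val_inj; rewrite /= mod0n.
- move=> a b x; rewrite -rotateD inZpD; congr (rotate _ x).
  by apply: val_inj; rewrite /= modn_dvdm.
- by rewrite cardK card_sum !card_ord; lia.
- by apply: stepZ_double_inj => //; rewrite /e /odd_bound; lia.
- exact: stepZ_inj.
- by move=> x k kK; apply: contraNneq (m2K x) => ->; apply: imset_f.
- by move=> x k kK; apply: contraNneq (m3K x) => ->; apply: imset_f.
Qed.

(** * Two equal cycles without fixed points *)

(** As [D] is even, parity recovers [u]; then [a] and [b] agree modulo [D./2] and lie in the same
    half. *)
Lemma double_mod_inj D a b (u v : bool) : ~~ odd D -> a < D -> b < D ->
  (D./2 <= a) = (D./2 <= b) -> 2 * a + u = 2 * b + v %[mod D] -> u = v /\ a = b.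
Proof.
move=> even_D lta ltb half_eq.
have lt1 : 2 * a + u < 2 * D by case: u; lia.
have lt2 : 2 * b + v < 2 * D by case: v; lia.
rewrite (modn_lt_double lt1) (modn_lt_double lt2).
by case: u v {lt1 lt2} => [] []; do !case: ifP; lia.
Qed.

Lemma equal_cycles_latin p :
  exists2 op : bool * 'I_p.+1 -> bool * 'I_p.+1 -> bool * 'I_p.+1,
    latin_op op & forall c, {morph (fun t => (t.1, t.2 + c)%R) : s t / op s t}.
Proof.
have pairI (a b : bool) (i j : 'I_p.+1) : (a, i) = (b, j) -> a = b /\ i = j by case.
case: (boolP (odd p.+1)) => [odd_p | even_p].
  exists (fun s t => (s.1 (+) t.1, t.2 + t.2 - s.2)%R) => [|c [x i] [y j]] /=; last first.
    by congr pair; rewrite addrACA opprD [RHS]addrACA addrK.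
  split=> [[x i]|[y j]] [x1 i1] [x2 i2] /pairI[] /=.
    move=> /addbI-> /addIr/(congr1 val)/= E; congr pair; apply: val_inj => /=.
    move: E (ltn_ord i1) (ltn_ord i2); rewrite !addnn -!mul2n.
    by rewrite !modn_lt_double ?ltn_pmul2l //; do !case: ifP; lia.
  by move=> /addIb-> /addrI/oppr_inj->.
(* A Cayley-type square: (x, i) * (y, j) = (x, i) + theta ((y, j) - (x, i)) for
   an orthomorphism theta of Z/2 x Z/(p+1), which exists as p+1 is even. *)
pose e (x y : bool) : 'I_p.+1 := inZp (x (+) y).
pose q (s t : bool * 'I_p.+1) := (t.2 - s.2 + e s.1 t.1)%R.
have qA c x y i j : q (x, i + c)%R (y, j + c)%R = q (x, i) (y, j).
  by congr (_ + _)%R; rewrite /= [(i + c)%R]addrC; exact: addrKA.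
exists (fun s t => (s.1 (+) (p.+1./2 <= q s t), t.2 + q s t)%R); last first.
  by move=> c [x i] [y j]; congr pair; rewrite qA //; exact: addrAC.
split=> [[x i]|[y j]] [x1 i1] [x2 i2] /pairI[].
  move=> /addbI E1 E2.
  (* The second coordinate is twice [q] plus [i - e x y], and the first tells in which half [q]
     lies; [double_mod_inj] recovers both [q] and [y]. *)
  have jE (y : bool) j : j = (q (x, i) (y, j) + (i - e x y))%R.
    by rewrite /q /= addrACA subrr addr0 subrK.
  suff [Ex Eq] : x1 = x2 /\ q (x, i) (x1, i1) = q (x, i) (x2, i2).
    by rewrite [i1](jE x1) [i2](jE x2) Eq Ex.
  have {E2} : (q (x, i) (x1, i1) + (i - e x x1) + q (x, i) (x1, i1) =
               q (x, i) (x2, i2) + (i - e x x2) + q (x, i) (x2, i2))%R.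
    by rewrite -!jE.
  have {}E1 : (p.+1./2 <= q (x, i) (x1, i1)) = (p.+1./2 <= q (x, i) (x2, i2)) := E1.
  move: (q (x, i) (x1, i1)) (q (x, i) (x2, i2)) E1 {jE} => q1 q2 E1 E2.
  have /(congr1 val) : (q1 + q1 + e x x2 = q2 + q2 + e x x1)%R.
    move/eqP: E2; rewrite addrAC [X in _ == X]addrAC !addrA subr_eq.
    rewrite [X in _ == X]addrAC eq_sym subr_eq (addrAC _ i) [X in _ == X](addrAC _ i).
    by move=> /eqP/addIr.
  rewrite /= !modnDm !addnn -!mul2n.
  move=> /(double_mod_inj even_p (ltn_ord _) (ltn_ord _) E1).
  by case=> /addbI-> /val_inj->.
move=> E1 /addrI E2; move: E1; rewrite E2 => /addIb E1.
have {}E1 : x1 = x2 := E1; move: E2; rewrite E1.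
by move=> /addIr/addrI/oppr_inj E2; congr pair.
Qed.

(** * Transport to ['I_n] and coordinates along the cycles *)

Lemma automorphism_transfer (T : finType) n (op : T -> T -> T) (a : T -> T)
    (alpha : 'S_n) (psi : T -> 'I_n) :
  latin_op op -> {morph a : s t / op s t} -> injective psi -> #|T| = n ->
  (forall t, alpha (psi t) = psi (a t)) -> alpha \in latin_Aut n.
Proof.
move=> [opr opc] opA psiI cardT alpha_psi.
have [|phi psiK phiK] := inj_card_bij psiI; first by rewrite cardT card_ord.
rewrite inE; apply/existsP; exists (\matrix_(i, j) psi (op (phi i) (phi j)))%R.
apply/andP; split; [apply/andP; split|]; apply/forallP => i.
- by apply/injectiveP=> j k; rewrite !mxE => /psiI/opr/(can_inj phiK).
- by apply/injectiveP=> j k; rewrite !mxE => /psiI/opc/(can_inj phiK).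
- apply/forallP=> j; rewrite !mxE alpha_psi opA.
  have phiA k : phi (alpha k) = a (phi k) by rewrite -{1}[k]phiK alpha_psi psiK.
  by rewrite !phiA.
Qed.

Lemma iter_porbit_inj (T : finType) (s : {perm T}) x i j :
  i < #|porbit s x| -> j < #|porbit s x| -> iter i s x = iter j s x -> i = j.
Proof.
have := uniq_traject_porbit s x; rewrite -{2 3}(size_traject s x #|porbit s x|).
move=> U lti ltj E; apply/eqP; rewrite -(nth_uniq x lti ltj U).
by rewrite !nth_traject ?E // -(size_traject s x #|porbit s x|).
Qed.

Lemma iter_porbit_mod (T : finType) (s : {perm T}) x i :
  iter (i %% #|porbit s x|) s x = iter i s x.
Proof.
rewrite [in RHS](divn_eq i #|porbit s x|) addnC iterD; congr (iter _ s _).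
by elim: (i %/ _) => //= k IH; rewrite mulSn iterD -IH iter_porbit.
Qed.

Lemma sum_card_porbits (T : finType) (s : {perm T}) :
  \sum_(C in porbits s) #|C| = #|T|.
Proof.
rewrite -sum1_card (partition_big_imset (porbit s)); apply: eq_bigr => C.
case/imsetP=> y _ ->; rewrite sum1dep_card; apply: eq_card => x.
by rewrite !inE eq_porbit_mem.
Qed.

Lemma fixed_porbit_card (T : finType) (s : {perm T}) x :
  (s x == x) = (#|porbit s x| == 1).
Proof.
apply/eqP/eqP => [sx | Ex]; last by have := iter_porbit s x; rewrite Ex.
apply/eqP; rewrite eqn_leq lt0n card_porbit_neq0 andbT leqNgt; apply/negP=> gt1.
by have := @iter_porbit_inj _ s x 0 1 (ltnW gt1) gt1 (esym sx).
Qed.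

Lemma perm_map_cons (S T : eqType) (g : S -> T) s a t :
  perm_eq (map g s) (a :: t) ->
  exists x s', [/\ perm_eq s (x :: s'), g x = a & perm_eq (map g s') t].
Proof.
move=> gs; have /mapP[x xs Ea] : a \in map g s by rewrite (perm_mem gs) mem_head.
exists x, (rem x s); split=> //; first exact: perm_to_rem.
rewrite -(perm_cons a); apply: perm_trans gs; rewrite perm_sym Ea.
exact: (perm_map g (perm_to_rem xs)).
Qed.

(** All other cycles have length 1, so points off the first two are fixed. As [d1] and [d2] exceed
    1, the fixed points avoid both cycles, and counting gives their number. *)
Lemma cycle_structure n (alpha : 'S_n) d1 d2 f : 1 < d1 -> 1 < d2 ->
  two_cycles_and_fixed_points alpha d1 d2 f ->
  exists p1 p2,
    [/\ #|porbit alpha p1| = d1, #|porbit alpha p2| = d2 &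
        p2 \notin porbit alpha p1] /\
    [/\ #|[set x | alpha x == x]| = f, n = d1 + (d2 + f) &
        forall x, [|| x \in porbit alpha p1, x \in porbit alpha p2 | alpha x == x]].
Proof.
move=> gt_d1 gt_d2; rewrite /two_cycles_and_fixed_points /cycle_lengths => cyc.
have En : n = d1 + (d2 + f).
  have := sum_card_porbits alpha; rewrite card_ord -big_enum.
  rewrite -(big_map (fun C : {set 'I_n} => #|C|) predT id) (perm_big _ cyc) /=.
  by rewrite !big_cons -sumnE sumn_nseq mul1n.
have [C1 [s1 [/[dup] /perm_mem s_s1 perm1 c1 /perm_map_cons]]] := perm_map_cons cyc.
case=> C2 [s2 [/[dup] /perm_mem s1_s2 perm2 c2 cs2]].
have mem_s C : (C \in porbits alpha) = [|| C == C1, C == C2 | C \in s2].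
  by rewrite -mem_enum s_s1 inE s1_s2 inE.
have /imsetP[p1 _ E1] : C1 \in porbits alpha by rewrite mem_s eqxx.
have /imsetP[p2 _ E2] : C2 \in porbits alpha by rewrite mem_s eqxx orbT.
have p21 : p2 \notin porbit alpha p1.
  have : uniq (C1 :: s1) by rewrite -(perm_uniq perm1) enum_uniq.
  by rewrite /= s1_s2 inE -eq_porbit_mem -E1 -E2 eq_sym => /andP[/norP[]].
have cover x : [|| x \in porbit alpha p1, x \in porbit alpha p2 | alpha x == x].
  rewrite -!eq_porbit_mem -E1 -E2 fixed_porbit_card.
  have := mem_s (porbit alpha x); rewrite imset_f // => /esym.
  case/or3P => [->|->|xs2]; rewrite ?orbT //.
  have : #|porbit alpha x| \in nseq f 1 by rewrite -(perm_mem cs2) map_f.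
  by rewrite mem_nseq => /andP[_ ->]; rewrite !orbT.
have gt_c1 : 1 < #|porbit alpha p1| by rewrite -E1 c1.
have gt_c2 : 1 < #|porbit alpha p2| by rewrite -E2 c2.
have unfix p x : 1 < #|porbit alpha p| -> x \in porbit alpha p -> alpha x != x.
  by rewrite fixed_porbit_card -eq_porbit_mem => gt1 /eqP->; rewrite gtn_eqF.
exists p1, p2; split; first by rewrite -{1}E1 -{1}E2.
split=> //; set F := [set x | alpha x == x].
have /eqP : #|C1 :|: C2| + #|F| == n.
  rewrite -cardsUI.
  have -> : C1 :|: C2 :|: F = setT.
    by apply/setP=> x; rewrite !inE E1 E2 -orbA cover.
  rewrite (_ : _ :&: F = set0) ?cards0 ?cardsT ?card_ord ?addn0 //.
  apply/setP=> x; rewrite !inE E1 E2; apply/negP=> /andP[/orP[] xp];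
    by apply/negP; move: xp; apply: unfix.
have : #|C1 :|: C2| + #|C1 :&: C2| = d1 + d2 by rewrite cardsUI c1 c2.
rewrite (_ : C1 :&: C2 = set0) ?cards0; first lia.
apply/setP=> x; rewrite !inE E1 E2; apply/negP=> /andP[].
rewrite -!eq_porbit_mem => /eqP-> E12; case/negP: p21.
by rewrite -eq_porbit_mem eq_sym.
Qed.

Definition next_point p q f : 'I_p.+1 + ('I_q.+1 + 'I_f) -> 'I_p.+1 + ('I_q.+1 + 'I_f) :=
  shift (fun _ => rotate (inZp 1)) (inZp 1).

Lemma mem_iter_porbit (T : finType) (s : {perm T}) i x : iter i s x \in porbit s x.
Proof. by rewrite -permX mem_porbit. Qed.

Lemma cycle_coordinates n (alpha : 'S_n) p q f : 0 < p -> 0 < q ->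
  two_cycles_and_fixed_points alpha p.+1 q.+1 f ->
  n = p.+1 + (q.+1 + f) /\
  exists2 psi : 'I_p.+1 + ('I_q.+1 + 'I_f) -> 'I_n,
    injective psi & forall t, alpha (psi t) = psi (next_point t).
Proof.
move=> p_gt0 q_gt0 cyc.
have [||p1 [p2 [[c1 c2 p21] [cF En _]]]] := cycle_structure _ _ cyc; try lia.
(* Replacing [f] by the cardinal of the fixed set lets [enum_val] serve as coordinate without a
   cast. *)
split=> //; move: {En} (esym cF) cyc => -> _.
have disj x : x \in porbit alpha p2 -> x \notin porbit alpha p1.
  rewrite -!eq_porbit_mem => /eqP->; by rewrite eq_porbit_mem.
have unfix p' x : 1 < #|porbit alpha p'| -> x \in porbit alpha p' -> alpha x != x.
  by rewrite fixed_porbit_card -eq_porbit_mem => gt1 /eqP->; rewrite gtn_eqF.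
have unfix1 x : x \in porbit alpha p1 -> alpha x != x by apply: unfix; rewrite c1.
have unfix2 x : x \in porbit alpha p2 -> alpha x != x by apply: unfix; rewrite c2.
have mod1 k : iter (k %% p.+1) alpha p1 = iter k alpha p1 by rewrite -c1 iter_porbit_mod.
have mod2 k : iter (k %% q.+1) alpha p2 = iter k alpha p2 by rewrite -c2 iter_porbit_mod.
set F := [set x | alpha x == x].
exists (fun t : 'I_p.+1 + ('I_q.+1 + 'I_#|F|) => match t with
  | inl i => iter i alpha p1
  | inr (inl j) => iter j alpha p2
  | inr (inr x) => enum_val x end).
- have fixv (x : 'I_#|F|) : alpha (enum_val x) == enum_val x.
    by have := enum_valP x; rewrite inE.
  move=> [i|[j|x]] [i'|[j'|x']] E.
  + by congr inl; apply/val_inj/(iter_porbit_inj _ _ E); rewrite c1.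
  + by have /negP[] := disj _ (mem_iter_porbit alpha j' p2); rewrite -E mem_iter_porbit.
  + by have /negP[] := unfix1 _ (mem_iter_porbit alpha i p1); rewrite E.
  + by have /negP[] := disj _ (mem_iter_porbit alpha j p2); rewrite E mem_iter_porbit.
  + by congr (inr (inl _)); apply/val_inj/(iter_porbit_inj _ _ E); rewrite c2.
  + by have /negP[] := unfix2 _ (mem_iter_porbit alpha j p2); rewrite E.
  + by have /negP[] := unfix1 _ (mem_iter_porbit alpha i' p1); rewrite -E.
  + by have /negP[] := unfix2 _ (mem_iter_porbit alpha j' p2); rewrite -E.
  + by rewrite (enum_val_inj E).
- move=> [i|[j|x]] /=.
  + by rewrite modnDml mod1.
  + by rewrite modnDml mod2.
  + by apply/eqP; have := enum_valP x; rewrite inE.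
Qed.

(** * Sufficiency of the conditions *)

Lemma divides_sufficient n (alpha : 'S_n) p q f : q.+1 %| p.+1 -> 0 < q -> q < p ->
  f <= q.+1 -> odd q.+1 || (0 < f) ->
  two_cycles_and_fixed_points alpha p.+1 q.+1 f -> alpha \in latin_Aut n.
Proof.
move=> dv_qp q_gt0 lt_qp le_fq odd_qf cyc.
have [En [psi psiI alpha_psi]] := cycle_coordinates (ltn_trans q_gt0 lt_qp) q_gt0 cyc.
have [op opL opA] := two_cycle_latin dv_qp lt_qp le_fq odd_qf.
apply: (automorphism_transfer opL (opA (inZp 1)) psiI) => [|t].
  by rewrite !card_sum !card_ord.
rewrite alpha_psi; congr psi; case: t => [//|x]; congr inr; congr (rotate _ x).
by apply: val_inj; rewrite /= modn_dvdm.
Qed.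

Lemma equal_sufficient n (alpha : 'S_n) q f : 0 < q -> f <= 2 * q.+1 ->
  two_cycles_and_fixed_points alpha q.+1 q.+1 f -> alpha \in latin_Aut n.
Proof.
move=> q_gt0 le_f cyc.
have [En [psi psiI alpha_psi]] := cycle_coordinates q_gt0 q_gt0 cyc.
case: f => [|f] in le_f cyc psi psiI alpha_psi En *.
  have [op opL opA] := equal_cycles_latin q.
  pose theta (t : bool * 'I_q.+1) : 'I_q.+1 + ('I_q.+1 + 'I_0) :=
    if t.1 then inl t.2 else inr (inl t.2).
  have thetaI : injective theta by move=> [[] i] [[] j] //= [->].
  apply: (automorphism_transfer opL (opA (inZp 1)) (inj_comp psiI thetaI)).
    by rewrite card_prod card_bool !card_ord; lia.
  by move=> [[] i]; rewrite /= alpha_psi; congr psi; rewrite /theta /next_point /= addrC.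
have lt_f : f < (2 * q + 1).+1 by lia.
(* The cycle has even length [2 * q.+1], which is why [f = 0] was treated apart. Two steps along it
   preserve parity, so even and odd positions form the two cycles, with coordinate [i./2]. *)
have [||op opL opA] := @single_cycle_latin (2 * q + 1) f.+1; [lia | by rewrite orbT |].
pose half_ord (i : 'I_(2 * q + 1).+1) : 'I_q.+1 := inZp i./2.
pose theta (t : 'I_(2 * q + 1).+1 + 'I_f.+1) : 'I_q.+1 + ('I_q.+1 + 'I_f.+1) :=
  match t with
  | inl i => if odd i then inr (inl (half_ord i)) else inl (half_ord i)
  | inr x => inr (inr x) end.
have half_inj (i j : 'I_(2 * q + 1).+1) :
    half_ord i = half_ord j -> odd i = odd j -> i = j.
  move=> /(congr1 val)/=; have := ltn_ord i; have := ltn_ord j => lti ltj.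
  by rewrite !modn_small; [move=> *; apply: val_inj => /=| |]; lia.
have thetaI : injective theta.
  have inlI (A B : Type) (a b : A) : inl a = inl b :> A + B -> a = b by case.
  have inrI (A B : Type) (a b : B) : inr a = inr b :> A + B -> a = b by case.
  move=> [i|x] [j|y]; rewrite /theta; do ?case: ifP => // ?; try by [].
  - by move=> E; congr inl; apply: half_inj (inlI _ _ _ _ (inrI _ _ _ _ E)) _; lia.
  - by move=> E; congr inl; apply: half_inj (inlI _ _ _ _ E) _; lia.
  - by move=> E; congr inr; exact: inrI _ _ _ _ (inrI _ _ _ _ E).
apply: (automorphism_transfer opL (opA (inZp 2)) (inj_comp psiI thetaI)).
  by rewrite card_sum !card_ord; lia.
move=> [i|x]; rewrite /= alpha_psi //; congr psi.
set j := (inZp 2 + i)%R.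
have -> : odd j = odd i.
  rewrite /j /= modnDml modn_lt_double; last by have := ltn_ord i; lia.
  by case: ifP; lia.
have Ej : half_ord j = (inZp 1 + half_ord i)%R.
  have lti := ltn_ord i; have lt1 : 2 + i < 2 * (2 * q + 1).+1 by lia.
  apply: val_inj; rewrite /= modnDm modnDml (modn_lt_double lt1).
  case: ifP => lt2; first by congr (_ %% _); lia.
  by rewrite -[LHS]modnDr; congr (_ %% _); lia.
by rewrite Ej; case: ifP.
Qed.

(** * Necessity of the conditions *)

Lemma latin_Aut_op n (alpha : 'S_n) : alpha \in latin_Aut n ->
  exists2 op : 'I_n -> 'I_n -> 'I_n, latin_op op & {morph alpha : x y / op x y}.
Proof.
rewrite inE => /existsP[L /andP[/andP[/forallP Lr /forallP Lc] /forallP LA]].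
exists (fun i j => L i j).
  by split=> x; apply/injectiveP; [exact: Lr | exact: Lc].
by move=> i j; apply/eqP; exact: (forallP (LA i)).
Qed.

Lemma iter_fix_dvd (T : finType) (s : {perm T}) k x :
  (iter k s x == x) = (#|porbit s x| %| k).
Proof.
have lt0 : 0 < #|porbit s x| by rewrite lt0n card_porbit_neq0.
rewrite -iter_porbit_mod; apply/eqP/eqP => [E|-> //].
by apply: (iter_porbit_inj (ltn_pmod _ lt0) lt0).
Qed.

Lemma iter_morph (T : Type) (s : T -> T) (op : T -> T -> T) k :
  {morph s : x y / op x y} -> {morph iter k s : x y / op x y}.
Proof. by move=> sA x y; elim: k => //= k ->. Qed.

Lemma period_op (T : finType) (s : {perm T}) (op : T -> T -> T) k x y :
  {morph s : x y / op x y} ->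
  #|porbit s x| %| k -> #|porbit s y| %| k -> #|porbit s (op x y)| %| k.
Proof. by move=> sA; rewrite -!iter_fix_dvd iter_morph // => /eqP-> /eqP->. Qed.

Lemma period_left (T : finType) (s : {perm T}) (op : T -> T -> T) k x y :
  latin_op op -> {morph s : x y / op x y} ->
  #|porbit s y| %| k -> #|porbit s (op x y)| %| k -> #|porbit s x| %| k.
Proof.
case=> _ opc sA; rewrite -!iter_fix_dvd iter_morph // => /eqP-> /eqP E.
by apply/eqP; exact: opc E.
Qed.

Lemma period_right (T : finType) (s : {perm T}) (op : T -> T -> T) k x y :
  latin_op op -> {morph s : x y / op x y} ->
  #|porbit s x| %| k -> #|porbit s (op x y)| %| k -> #|porbit s y| %| k.
Proof.
case=> opr _ sA; rewrite -!iter_fix_dvd iter_morph // => /eqP-> /eqP E.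
by apply/eqP; exact: opr E.
Qed.

(** If [x] and [op p1 x] were both fixed, so would be [p1]. Hence row [p1] injects the fixed points
    into the [2 * d] moved ones. *)
Lemma equal_necessary n (alpha : 'S_n) d f : 1 < d ->
  two_cycles_and_fixed_points alpha d d f -> alpha \in latin_Aut n -> f <= 2 * d.
Proof.
move=> d_gt1 cyc /latin_Aut_op[op opL opA].
have [p1 [p2 [[c1 _ _] [cF En _]]]] := cycle_structure d_gt1 d_gt1 cyc.
set F := [set x | alpha x == x] in cF.
have sub : op p1 @: F \subset ~: F.
  apply/subsetP=> _ /imsetP[x xF ->]; move: xF.
  rewrite !inE !fixed_porbit_card -!dvdn1 => xF; apply/negP=> opF.
  by have := period_left opL opA xF opF; rewrite c1 dvdn1; lia.
have := subset_leq_card sub; rewrite card_imset; last by case: opL.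
rewrite -(leq_add2l f) -{2}cF cardsC card_ord cF; lia.
Qed.

(** If [q.+1 = 2m], the integer sum is [m(2m - 1)], not a multiple of [2m]. *)
Lemma sum_ord_odd q : (\sum_(k < q.+1) k = 0 :> 'I_q.+1)%R -> odd q.+1.
Proof.
move=> sum0.
have : inZp (\sum_(k < q.+1) k) = 0%R :> 'I_q.+1.
  rewrite -sum0 (@big_morph _ _ (@inZp q) 0%R +%R 0 addn) //.
  - by apply: eq_bigr => k _; rewrite valZpK.
  - by move=> a b; rewrite inZpD.
  - by apply: val_inj; rewrite /= mod0n.
rewrite -(big_mkord xpredT id) bin2_sum => /(congr1 val)/=/eqP.
rewrite -/(_ %| _) bin2 => dv; case: (boolP (odd q.+1)) => // even_q.
have [m Em] : exists m, q.+1 = m.*2 by exists q.+1./2; lia.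
move: dv; rewrite Em -doubleMl doubleK -muln2.
by rewrite dvdn_pmul2l; lia.
Qed.

(** Row [p] gives a permutation [g] of Z/(q+1), and column [p] shows that [delta k = g k - k] is one
    too. Summing [delta] over the group gives 0, yet it is the sum of all elements. *)
Lemma full_cycle_odd (T : finType) (s : {perm T}) (op : T -> T -> T) p :
  latin_op op -> {morph s : x y / op x y} ->
  (forall x, x \in porbit s p -> op p x \in porbit s p) -> odd #|porbit s p|.
Proof.
move=> [opr opc] sA closed; have := card_porbit_neq0 s p.
case card_p: #|porbit s p| => [//|q] _.
pose pt (k : 'I_q.+1) := iter k s p.
have ptI : injective pt.
  by move=> k l E; apply/val_inj/(iter_porbit_inj _ _ E); rewrite card_p.
have mod_p m : iter (m %% q.+1) s p = iter m s p by rewrite -card_p iter_porbit_mod.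
have iter_pt k l : iter (k : 'I_q.+1) s (pt l) = pt (k + l)%R.
  by rewrite -iterD /pt /= mod_p.
have /fin_all_exists[g gE] k : exists l, op p (pt k) = pt l.
  have := closed (pt k) (mem_iter_porbit s k p).
  case/porbitP => i; rewrite permX -mod_p => ->.
  by exists (inZp i).
have gI : injective g by move=> k l E; apply/ptI/(opr p); rewrite !gE E.
pose delta k := (g k - k)%R.
have dI : injective delta.
  have dE k : op (pt (- k)%R) p = pt (delta k).
    rewrite /delta addrC -iter_pt -gE iter_morph // iter_pt addNr.
    by congr (op _ _).
  by move=> k l E; apply/oppr_inj/ptI/(opc p); rewrite !dE E.
apply: sum_ord_odd; have := reindex_inj dI.
move=> /(_ _ _ _ xpredT id) /= ->; rewrite sumrB.
by have /= <- := reindex_inj gI (P := xpredT) (F := id); rewrite subrr.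
Qed.

Lemma unequal_necessary n (alpha : 'S_n) d1 d2 f : d2 < d1 -> 1 < d2 ->
  two_cycles_and_fixed_points alpha d1 d2 f -> alpha \in latin_Aut n ->
  [/\ d2 %| d1, f <= d2 & (~~ odd d2 -> 0 < f)].
Proof.
move=> lt_d21 d2_gt1 cyc /latin_Aut_op[op opL opA].
have [p1 [p2 [[c1 c2 _] [cF _ cover]]]] :=
  cycle_structure (ltn_trans d2_gt1 lt_d21) d2_gt1 cyc.
set F := [set x | alpha x == x] in cF.
have ndv : ~~ (d1 %| d2) by apply/negP => /dvdn_leq; lia.
have card_eq p x : x \in porbit alpha p -> #|porbit alpha x| = #|porbit alpha p|.
  by rewrite -eq_porbit_mem => /eqP->.
(* The period of [op p2 x] divides [d2], which excludes the long cycle. *)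
have row2 x : #|porbit alpha x| %| d2 ->
    (op p2 x \in porbit alpha p2) || (op p2 x \in F).
  move=> xd; have := period_op opA _ xd; move/(_ p2); rewrite c2 dvdnn => /(_ isT).
  by case/or3P: (cover (op p2 x)) => [/card_eq->|->|];
    rewrite ?inE ?c1 ?(negPf ndv) // => ->; rewrite orbT.
split.
(* Off the long cycle, [op p1 p2] has period dividing [d2], as does [p2], which would force [d1] to
   divide [d2]. *)
- case/or3P: (cover (op p1 p2)) => [/card_eq|/card_eq|]; rewrite ?c1 ?c2.
  + by move=> c; rewrite -c2; apply: (period_right opL opA (x := p1)); rewrite ?c1 ?c.
  + move=> c; case/negP: ndv; rewrite -c1.
    by apply: (period_left opL opA (y := p2)); rewrite ?c2 ?c.
  + rewrite fixed_porbit_card => /eqP c; case/negP: ndv; rewrite -c1.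
    by apply: (period_left opL opA (y := p2)); rewrite ?c2 ?c ?dvd1n.
(* Row [p2] maps fixed points into the short cycle, for otherwise [p2] would be fixed. *)
- rewrite -cF -c2 -(card_imset (mem F) (f := op p2)); last by case: opL.
  apply/subset_leq_card/subsetP=> _ /imsetP[x xF ->].
  have x1 : #|porbit alpha x| %| 1 by move: xF; rewrite inE fixed_porbit_card -dvdn1.
  have /orP[//|] := row2 x (dvdn_trans x1 (dvd1n _)).
  rewrite inE fixed_porbit_card -dvdn1 => op1.
  by have := period_left opL opA x1 op1; rewrite c2 dvdn1; lia.
(* Without fixed points, row [p2] maps the short cycle into itself. *)
- apply: contraR; rewrite -leqNgt leqn0 => /eqP f0.
  rewrite -c2; apply: (full_cycle_odd opL opA) => x xp2.
  have xd : #|porbit alpha x| %| d2 by rewrite (card_eq _ _ xp2) c2.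
  have /orP[//|] := row2 x xd.
  by rewrite (cards0_eq (etrans cF f0)) inE.
Qed.

Theorem theorem7p1 (n d1 d2 dinf : nat) (alpha : 'S_n)
    (hd21 : d2 <= d1) (hd2 : 1 < d2)
    (halpha : two_cycles_and_fixed_points alpha d1 d2 dinf) :
  (d1 = d2 -> (alpha \in latin_Aut n <-> 0 <= dinf <= 2 * d1)) /\
  (d2 < d1 ->
    (alpha \in latin_Aut n <->
      [/\ d2 %| d1, dinf <= d2 & (~~ odd d2 -> 0 < dinf)])).
Proof.
split=> [E | lt_d21].
  subst d1; split; first exact: equal_necessary.
  by case: d2 hd2 halpha {hd21} => // q q_gt0 cyc le_f; apply: equal_sufficient cyc.
split; first exact: unequal_necessary.
case: d2 d1 hd2 lt_d21 halpha {hd21} => // q [//|p] q_gt0 lt_qp cyc [dv le_f even_f].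
apply: divides_sufficient cyc => //.
by case: (boolP (odd q.+1)) => // /even_f ->.
Qed.
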